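(* Let $X$ be an $\mathbb{R}^d$-valued random vector, $T:\mathbb{R}^d\to\mathbb{R}^d$ any contraction, and $W$ a random vector uniformly distributed on the unit ball $B(0,1)\subset\mathbb{R}^d$ and independent of $X$. Then for $\alpha=2,3,\dots,d+3$, $$h_\alpha(T(X)+W)\le h_\alpha(X+W).$$
   Context: $B(0,1)$ is the open Euclidean unit ball centered at the origin. A contraction is a $1$-Lipschitz map for the Euclidean norm. For a random vector $Y$ with density $f$ and $\alpha\in(0,1)\cup(1,\infty)$, $h_\alpha(Y)=\frac{1}{1-\alpha}\log\int_{\mathbb{R}^d}f^\alpha$ is the Rényi entropy of order $\alpha$. *)

(* Defs.v *)
From HB Require Import structures.
From mathcomp Require Import all_boot all_order all_algebra.
From mathcomp Require Import all_classical all_reals all_analysis.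

Set Implicit Arguments.
Unset Strict Implicit.
Unset Printing Implicit Defensive.

Import Order.TTheory GRing.Theory Num.Theory.
Import numFieldNormedType.Exports.

Local Open Scope classical_set_scope.
Local Open Scope ring_scope.

(* R^n is 'rV[R]_n.  Its sigma-algebra is the one generated by the coordinates,
   as the library does for n.-tuple; it is the Borel sigma-algebra. *)
Fact rV_display : measure_display. Proof. exact. Qed.

Section measurable_rV.
Context {R : realType} (n : nat).

Let coord (i : 'I_n) (v : 'rV[R]_n) : R := v ord0 i.

Let rV_set0 : g_sigma_preimage coord set0.
Proof. exact: sigma_algebra0. Qed.

Let rV_setC A : g_sigma_preimage coord A -> g_sigma_preimage coord (~` A).
Proof. exact: sigma_algebraC. Qed.

Let rV_bigcup (F : _^nat) : (forall i, g_sigma_preimage coord (F i)) ->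
  g_sigma_preimage coord (\bigcup_i (F i)).
Proof. exact: sigma_algebra_bigcup. Qed.

HB.instance Definition _ := @isMeasurable.Build rV_display
  'rV[R]_n (g_sigma_preimage coord) rV_set0 rV_setC rV_bigcup.

Lemma measurable_coord (i : 'I_n) :
  measurable_fun [set: 'rV[R]_n] (fun v : 'rV[R]_n => v ord0 i).
Proof.
move=> _ Y mY; rewrite setTI; apply: sub_sigma_algebra => /=.
rewrite -bigcup_seq/=; exists i => /=; first by rewrite mem_index_enum.
by exists Y => //; rewrite setTI.
Qed.

Lemma measurable_fun_rVP d (T : measurableType d) (f : T -> 'rV[R]_n) :
  measurable_fun [set: T] f <->
  forall i, measurable_fun [set: T] (fun t => f t ord0 i).
Proof.
split=> [mf i|mf].
  exact: (measurableT_comp (measurable_coord i) mf).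
move=> _ A mA; rewrite setTI.
pose G := [set A : set 'rV[R]_n | measurable (f @^-1` A)].
suff : measurable `<=` G by exact.
apply: smallest_sub.
  split; rewrite /G /=.
  - by rewrite preimage_set0.
  - by move=> B mB; rewrite setTD preimage_setC; exact: measurableC.
  - by move=> F mF; rewrite preimage_bigcup; exact: bigcup_measurable.
rewrite -bigcup_seq => B [i _ [C mC <-]].
rewrite /G /= setTI; have := mf i measurableT C mC; rewrite setTI.
exact.
Qed.

End measurable_rV.

Section lebesgue_rV.
Context {R : realType}.

Definition rV_cons n (p : R * 'rV[R]_n) : 'rV[R]_n.+1 :=
  row_mx (p.1)%:M p.2 : 'rV[R]_(1 + n).

Definition rV_uncons n (v : 'rV[R]_n.+1) : R * 'rV[R]_n :=
  (v ord0 ord0, rsubmx (v : 'rV[R]_(1 + n))).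

Lemma rV_cons0 n (p : R * 'rV[R]_n) : rV_cons p ord0 ord0 = p.1.
Proof.
have -> : ord0 = lshift n (ord0 : 'I_1) by apply: val_inj.
by rewrite [LHS](row_mxEl (p.1%:M : 'M[R]_1)) mxE eqxx.
Qed.

Lemma rV_consS n (p : R * 'rV[R]_n) j : rV_cons p ord0 (lift ord0 j) = p.2 ord0 j.
Proof.
have -> : lift ord0 j = rshift 1 j by apply: val_inj.
by rewrite [LHS](row_mxEr (p.1%:M : 'M[R]_1)).
Qed.

Lemma rV_consK n : cancel (@rV_cons n) (@rV_uncons n).
Proof.
by move=> [x v]; congr pair; [exact: rV_cons0|exact: row_mxKr].
Qed.

Lemma measurable_rV_cons n : measurable_fun setT (@rV_cons n).
Proof.
apply/measurable_fun_rVP => i; have [j ->|->] := unliftP ord0 i.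
  under eq_fun do rewrite rV_consS.
  exact: (measurableT_comp (measurable_coord j) measurable_snd).
by under eq_fun do rewrite rV_cons0; exact: measurable_fst.
Qed.

Lemma measurable_rV_uncons n : measurable_fun setT (@rV_uncons n).
Proof.
apply/measurable_fun_pair; first exact: measurable_coord.
apply/measurable_fun_rVP => i.
under eq_fun do rewrite mxE.
exact: measurable_coord.
Qed.

Section lebesgue_rV_succ.
Context n (mu : {sigma_finite_measure set 'rV[R]_n -> \bar R}).

Definition lebesgue_rV_succ : set 'rV[R]_n.+1 -> \bar R :=
  pushforward (@lebesgue_measure R \x mu)%E (@rV_cons n).

Let succ0 : lebesgue_rV_succ set0 = 0%E.
Proof. by rewrite /lebesgue_rV_succ /pushforward preimage_set0 measure0. Qed.

Let succ_ge0 A : (0 <= lebesgue_rV_succ A)%E.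
Proof. exact: (measure_ge0 (@lebesgue_measure R \x mu)%E). Qed.

Let succ_sigma_additive : semi_sigma_additive lebesgue_rV_succ.
Proof.
have mcons := @measurable_rV_cons n.
exact: (@measure_semi_sigma_additive _ _ _
  (pushforward (@lebesgue_measure R \x mu)%E (@rV_cons n))).
Qed.

HB.instance Definition _ := isMeasure.Build _ _ _ lebesgue_rV_succ
  succ0 succ_ge0 succ_sigma_additive.

Lemma sigma_finite_lebesgue_rV_succ : sigma_finite setT lebesgue_rV_succ.
Proof.
have /sigma_finiteP[F [TF ndF Foo]] := sigma_finiteT (@lebesgue_measure R).
have /sigma_finiteP[G [TG ndG Goo]] := sigma_finiteT mu.
exists (fun k => @rV_uncons n @^-1` (F k `*` G k)).
  rewrite -preimage_bigcup (_ : \bigcup_i _ = setT) ?preimage_setT//.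
  rewrite -setXTT TF TG predeqE => -[x y]; split.
    by move=> [k _ []/= ? ?]; split; exists k.
  move=> [/= [k _ Fx] [l _ Gy]]; exists (maxn k l) => //; split.
    by move: x Fx; exact/subsetPset/ndF/leq_maxl.
  by move: y Gy; exact/subsetPset/ndG/leq_maxr.
move=> k; have [mF Fk] := Foo k; have [mG Gk] := Goo k; split.
  rewrite -[X in measurable X]setTI.
  by apply: measurable_rV_uncons => //; exact: measurableX.
rewrite /lebesgue_rV_succ /pushforward -comp_preimage.
rewrite (_ : _ \o _ = id); last by apply/funext => p; exact: rV_consK.
by rewrite preimage_id product_measure1E// lte_mul_pinfty// ge0_fin_numE.
Qed.

HB.instance Definition _ := Measure_isSigmaFinite.Build _ _ _
  lebesgue_rV_succ sigma_finite_lebesgue_rV_succ.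

End lebesgue_rV_succ.

Fixpoint lebesgue_rV n : {sigma_finite_measure set 'rV[R]_n -> \bar R} :=
  match n with
  | 0 => \d_(0 : 'rV[R]_0)
  | n'.+1 => lebesgue_rV_succ (lebesgue_rV n')
  end.

End lebesgue_rV.

Lemma measurable_rV_box {R : realType} n (A : 'I_n -> set R) :
  (forall i, measurable (A i)) ->
  measurable [set v : 'rV[R]_n | forall i, A i (v ord0 i)].
Proof.
move=> mA; have -> : [set v : 'rV[R]_n | forall i, A i (v ord0 i)] =
    \bigcap_(i in [set: 'I_n]) ((fun v : 'rV[R]_n => v ord0 i) @^-1` A i).
  by apply/seteqP; split=> [v vA i _|v vA i]; [exact: vA|exact: (vA i)].
apply: fin_bigcap_measurable => // i _.
by rewrite -[X in measurable X]setTI; exact: measurable_coord.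
Qed.

Lemma lebesgue_rV_box {R : realType} n (A : 'I_n -> set R) :
  (forall i, measurable (A i)) ->
  lebesgue_rV n [set v | forall i, A i (v ord0 i)]
  = (\prod_(i < n) lebesgue_measure (A i))%E.
Proof.
elim: n A => [|n IHn] A mA.
  by rewrite big_ord0 /= diracE mem_set// => -[].
rewrite big_ord_recl -(IHn (fun i => A (lift ord0 i)))//.
have mS := measurable_rV_box (fun i => mA (lift ord0 i)).
transitivity ((@lebesgue_measure R \x lebesgue_rV n)%E (A ord0 `*`
    [set v : 'rV[R]_n | forall i : 'I_n, A (lift ord0 i) (v ord0 i)])); last first.
  by rewrite product_measure1E//; exact: (mA ord0).
rewrite /= /lebesgue_rV_succ /pushforward; congr product_measure1.
apply/seteqP; split=> p /=.
  by move=> H; split=> [|i]; [rewrite -rV_cons0|rewrite -rV_consS]; exact: H.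
move=> [A0 AS] i; have [j ->|->] := unliftP ord0 i.
  by rewrite rV_consS; exact: AS.
by rewrite rV_cons0.
Qed.

Section renyi_entropy.
Context {R : realType}.

(* The library norm on 'rV[R]_n is the sup norm. *)
Definition euclidean_norm n (x : 'rV[R]_n) : R :=
  Num.sqrt (\sum_(i < n) x ord0 i ^+ 2).

Definition euclidean_unit_ball n : set 'rV[R]_n :=
  [set x | euclidean_norm x < 1].

Definition euclidean_contraction n (T : 'rV[R]_n -> 'rV[R]_n) :=
  forall x y, euclidean_norm (T x - T y) <= euclidean_norm (x - y).

Context {d0} {Omega : measurableType d0} (P : probability Omega R).

Definition independent_RV d1 d2 (T1 : measurableType d1)
    (T2 : measurableType d2) (X : Omega -> T1) (Y : Omega -> T2) :=
  forall A B, measurable A -> measurable B ->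
    (P (X @^-1` A `&` Y @^-1` B) = P (X @^-1` A) * P (Y @^-1` B))%E.

Context {d : nat}.
Implicit Types (Y : Omega -> 'rV[R]_d) (f : 'rV[R]_d -> R).

Definition uniform_on Y (B : set 'rV[R]_d) :=
  forall A, measurable A ->
    P (Y @^-1` A) = (lebesgue_rV d (A `&` B) / lebesgue_rV d B)%E.

Definition is_density Y f :=
  [/\ measurable_fun setT f, (forall x, 0 <= f x) &
      forall A, measurable A ->
        P (Y @^-1` A) = (\int[lebesgue_rV d]_(x in A) (f x)%:E)%E].

(* Densities of Y agree almost everywhere, so the entropy below does not depend
   on the one chosen here; if Y has no density, this is the zero function. *)
Definition density Y : 'rV[R]_d -> R := xget (fun=> 0) [set f | is_density Y f].

Definition renyi_entropy (alpha : R) Y : \bar R :=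
  (((1 - alpha)^-1)%:E *
   lne (\int[lebesgue_rV d]_x ((density Y x) `^ alpha)%:E))%E.

End renyi_entropy.

(* Main.v *)
(* A density of X + W is x |-> P(|x - X| < 1) / vol B(0, 1), so the integral of
   its alpha-th power is, up to a constant, the expected volume of the
   intersection of alpha independent unit balls B(X_i, 1).  It is thus enough to
   show that the volume of the intersection of N <= d + 3 unit balls of R^d does
   not decrease when the distances D_ij = |p_i - p_j|^2 decrease.

   Approximate the indicator of [0, 1[ by q(u) = sum_k c_k exp (- w_k u).  Then
   the integral of prod_i q(|x - p_i|^2) over R^d is a finite sum of Gaussian
   integrals, hence an explicit function F(D).  The extra factor pi / A (A the
   total weight of the exponential) gained by a Gaussian integral when the
   dimension grows by 2 gives
     dF/dD_ij = - 1 / pi * (integral over R^(d + 2) of d_i d_j prod_l q(u_l)),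
   which is nonpositive as q >= 0 >= q', provided that D is the matrix of squared
   distances of N points of R^(d + 2).  This holds along the segment joining the
   two matrices of interest because N points always lie in dimension N - 1. *)
Require Import Defs.
From HB Require Import structures.
From mathcomp Require Import all_boot all_order all_algebra.
From mathcomp Require Import all_classical all_reals all_analysis.
From mathcomp Require Import measurable_realfun.
From mathcomp Require Import ring lra.

Set Implicit Arguments.
Unset Strict Implicit.
Unset Printing Implicit Defensive.

Import Order.TTheory GRing.Theory Num.Theory.
Import numFieldNormedType.Exports.

Local Open Scope classical_set_scope.
Local Open Scope ring_scope.

(** * Realizing squared distances *)

(** Cholesky factorization by induction on the rows: [m] vectors span a space of dimension at most
    [m], so their inner products are already realized there. *)
Lemma gram_square (R : rcfType) m n (Z : 'M[R]_(m, n)) :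
  exists Z' : 'M[R]_(m, m), Z *m Z^T = Z' *m Z'^T.
Proof.
elim: m => [|m IHm] in Z *; first by exists 0; apply/matrixP => -[].
suff [Z' ZZ'] : exists Z' : 'M[R]_(1 + m, 1 + m), Z *m Z^T = Z' *m Z'^T by exists Z'.
have blockE (a : 'M[R]_1) (b : 'cV[R]_m) (c : 'M[R]_m) :
    block_mx a 0 b c *m (block_mx a 0 b c)^T =
    block_mx (a *m a^T) (a *m b^T) (b *m a^T) (b *m b^T + c *m c^T).
  rewrite (@tr_block_mx _ 1 m 1 m) mulmx_block.
  by rewrite !(trmx0, mul0mx, mulmx0, addr0).
have rowE (z : 'rV[R]_n) (Y : 'M[R]_(m, n)) :
    (col_mx z Y : 'M[R]_(m.+1, n)) *m (col_mx z Y : 'M[R]_(m.+1, n))^T =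
    block_mx (z *m z^T) (z *m Y^T) (Y *m z^T) (Y *m Y^T) :> 'M[R]_(1 + m).
  by rewrite [LHS](_ : _ = col_mx z Y *m (col_mx z Y)^T) // tr_col_mx mul_col_row.
rewrite -[Z](@vsubmxK _ 1 m); move: (usubmx _) (dsubmx _) => z Y.
pose s := (z *m z^T) 0 0.
have zz : z *m z^T = s%:M by rewrite [LHS]mx11_scalar.
have s_ge0 : 0 <= s.
  by rewrite /s mxE sumr_ge0// => i _; rewrite mxE -expr2 sqr_ge0.
have [s0|s_neq0] := eqVneq s 0.
  have z0 : z = 0.
    apply/rowP => j; rewrite mxE; apply/eqP; rewrite -sqrf_eq0.
    move/eqP: s0; rewrite /s mxE psumr_eq0.
      by move/allP/(_ j (mem_index_enum _)); rewrite mxE -expr2.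
    by move=> i _; rewrite mxE -expr2 sqr_ge0.
  have [Y' YY'] := IHm Y.
  exists (block_mx (0 : 'M[R]_1) 0 0 Y').
  rewrite z0 blockE -YY' rowE.
  by rewrite !(trmx0, mul0mx, mulmx0, add0r).
(* The rows of [Y] are replaced with their components orthogonal to [z], whose Gram matrix is the
   Schur complement of [s]. *)
have [Y' YY'] := IHm (Y - s^-1 *: (Y *m z^T *m z)).
exists (block_mx (Num.sqrt s)%:M 0 ((Num.sqrt s)^-1 *: (Y *m z^T)) Y').
rewrite blockE -YY' rowE zz tr_scalar_mx -scalar_mxM -expr2 sqr_sqrtr//.
have r_neq0 : Num.sqrt s != 0 by rewrite sqrtr_eq0 -ltNge lt0r s_neq0.
rewrite -[RHS]/(@block_mx _ 1 m 1 m _ _ _ _); congr (@block_mx _ 1 m 1 m _ _ _ _).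
- by rewrite linearZ/= trmx_mul trmxK mul_scalar_mx scalerA divff// scale1r.
- by rewrite mul_mx_scalar scalerA divff// scale1r.
- set v := Y *m z^T; have vE : v^T = z *m Y^T by rewrite trmx_mul trmxK.
  have -> : (Y - s^-1 *: (v *m z))^T = Y^T - s^-1 *: (z^T *m v^T).
    by rewrite linearB linearZ/= trmx_mul.
  rewrite linearZ/= mulmxBl !mulmxBr -!scalemxAl -!scalemxAr !scalerA.
  rewrite -(mulmxA v z Y^T) -vE (mulmxA Y) -/v -(mulmxA v z (z^T *m v^T)) (mulmxA z) zz.
  rewrite mul_scalar_mx -scalemxAr scalerA -mulrA mulVf// mulr1 subrr subr0.
  by rewrite -invfM -expr2 sqr_sqrtr// addrC subrK.
Qed.

Definition sqdist (R : realType) n (x y : 'rV[R]_n) : R :=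
  \sum_k (x ord0 k - y ord0 k) ^+ 2.

Section sqdist.
Context {R : realType}.

Lemma sqdist_ge0 n (x y : 'rV[R]_n) : 0 <= sqdist x y.
Proof. by apply: sumr_ge0 => k _; exact: sqr_ge0. Qed.

Lemma sqdistxx n (x : 'rV[R]_n) : sqdist x x = 0.
Proof. by apply: big1 => k _; rewrite subrr expr0n. Qed.

Lemma sqdist_mulmx n (x y : 'rV[R]_n) :
  sqdist x y = ((x - y) *m (x - y)^T) ord0 ord0.
Proof. by rewrite mxE; apply: eq_bigr => k _; rewrite !mxE expr2. Qed.

Lemma measurable_sqdist n (y : 'rV[R]_n) : measurable_fun setT (fun x => sqdist x y).
Proof.
apply: measurable_sum => k; apply: measurable_funX; apply: measurable_funB => //.
exact: measurable_coord.
Qed.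

(* The natural realization is (sqrt (1 - t) p_i, sqrt t q_i) in R^(d + d); only
   the Gram matrix of its N - 1 differences matters. *)
Lemma sqdist_convex_realization d N (p q : 'I_N -> 'rV[R]_d) (t : R) :
  (N <= d + 3)%N -> 0 <= t <= 1 ->
  exists y : 'I_N -> 'rV[R]_(d + 2), forall i j,
    sqdist (y i) (y j) = (1 - t) * sqdist (p i) (p j) + t * sqdist (q i) (q j).
Proof.
case: N p q => [|m] p q Nd /andP[t0 t1]; first by exists (fun=> 0) => -[].
pose z i : 'rV[R]_(d + d) := row_mx (Num.sqrt (1 - t) *: p i) (Num.sqrt t *: q i).
have zE i j : sqdist (z i) (z j) =
    (1 - t) * sqdist (p i) (p j) + t * sqdist (q i) (q j).
  rewrite /sqdist big_split_ord/=; congr (_ + _); rewrite mulr_sumr.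
    apply: eq_bigr => k _; rewrite !row_mxEl !mxE -mulrBr exprMn sqr_sqrtr//; lra.
  by apply: eq_bigr => k _; rewrite !row_mxEr !mxE -mulrBr exprMn sqr_sqrtr.
pose Z : 'M[R]_(m, d + d) := \matrix_i (z (lift ord0 i) - z ord0).
(* [e ord0] is zero and the other [e i] form the standard basis, so [Z] carries [e i] to the
   difference with the base point [z ord0]. *)
pose e (i : 'I_m.+1) : 'rV[R]_m := \row_k (i == lift ord0 k)%:R.
have eZ i : z i - z ord0 = e i *m Z.
  rewrite mulmx_sum_row; case: (unliftP ord0 i) => [j ->|->].
    rewrite (bigD1 j)//= rowK mxE eqxx scale1r big1 ?addr0// => k kj.
    by rewrite mxE (inj_eq lift_inj) eq_sym (negbTE kj) scale0r.
  by rewrite subrr big1// => k _; rewrite mxE (negbTE (neq_lift _ _)) scale0r.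
(* [gram_square] yields vectors of length [m]; since [m <= d + 2], [pid_mx m] pads them with
   zeros. *)
have [Y YZ] : exists Y : 'M[R]_(m, d + 2), Y *m Y^T = Z *m Z^T.
  have [Z' ->] := gram_square Z; exists (Z' *m pid_mx m).
  rewrite trmx_mul tr_pid_mx mulmxA -(mulmxA Z') mul_pid_mx minnn (minn_idPr _).
    by rewrite pid_mx_1 mulmx1.
  by move: Nd; rewrite addn3 addn2.
exists (fun i => e i *m Y) => i j; rewrite -zE !sqdist_mulmx.
have -> : z i - z j = (e i - e j) *m Z.
  by rewrite mulmxBl -!eZ opprB addrA subrK.
rewrite /= -mulmxBl; move: (e i - e j) => v.
rewrite (trmx_mul v Y) (trmx_mul v Z) !mulmxA.
by rewrite -(mulmxA v Y) YZ !mulmxA.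
Qed.

End sqdist.

(** * Gaussian integrals *)

(* The integral over R^n of exp (- sum_i v_i |x - p_i|^2), as a function of the
   squared distances D between the p_i; it is also used for matrices D that are
   not realized by points of R^n. *)
Definition gauss_mass (R : realType) N (n : nat) (v : 'I_N -> R)
    (D : 'I_N -> 'I_N -> R) : R :=
  Num.sqrt (pi / \sum_i v i) ^+ n *
  expR (- ((\sum_i \sum_j v i * v j * D i j) / (2 * \sum_i v i))).

Section gauss.
Context {R : realType}.
Notation leb := (@lebesgue_measure R).

Lemma ge0_integral_rVS n (f : 'rV[R]_n.+1 -> \bar R) :
  measurable_fun setT f -> (forall x, (0 <= f x)%E) ->
  (\int[lebesgue_rV n.+1]_x f x =
   \int[leb]_t \int[lebesgue_rV n]_v f (rV_cons (t, v)))%E.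
Proof.
move=> mf f0.
transitivity (\int[leb \x lebesgue_rV n]_p f (rV_cons p))%E.
  have := @ge0_integral_pushforward _ _ (measurableTypeR R * 'rV[R]_n)%type _ _ _
    (@measurable_rV_cons R n) (leb \x lebesgue_rV n)%E setT f measurableT mf (fun y _ => f0 y).
  by rewrite preimage_setT => H; exact: H.
by rewrite fubini_tonelli1//; apply: measurableT_comp => //; exact: measurable_rV_cons.
Qed.

Lemma ge0_integral_rV_prod n (h : 'I_n -> R -> R) :
  (forall i, measurable_fun setT (h i)) -> (forall i t, 0 <= h i t) ->
  (\int[lebesgue_rV n]_x (\prod_(i < n) h i (x ord0 i))%:E =
   \prod_(i < n) \int[leb]_t (h i t)%:E)%E.
Proof.
elim: n h => [|n IHn] h mh h0.
  rewrite big_ord0; under eq_integral do rewrite big_ord0.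
  by rewrite integral_cst//= diracT mule1.
rewrite big_ord_recl ge0_integral_rVS; last 2 first.
- apply/measurable_EFinP; apply: measurable_prod => i _.
  by apply: measurableT_comp => //; exact: measurable_coord.
- by move=> x; rewrite lee_fin prodr_ge0.
rewrite -IHn//.
have H0 : (0 <= \int[lebesgue_rV n]_x (\prod_(i < n) h (lift ord0 i) (x ord0 i))%:E)%E.
  by apply: integral_ge0 => x _; rewrite lee_fin prodr_ge0.
rewrite -ge0_integralZr//; last 2 first.
- by apply/measurable_EFinP; exact: mh.
- by move=> t _; rewrite lee_fin.
apply: eq_integral => t _.
rewrite -ge0_integralZl//; last 3 first.
- apply/measurable_EFinP; apply: measurable_prod => i _.
  by apply: measurableT_comp => //; exact: measurable_coord.
- by move=> x _; rewrite lee_fin prodr_ge0.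
- by rewrite lee_fin.
apply: eq_integral => v _; rewrite big_ord_recl rV_cons0 EFinM; congr (_ * _%:E)%E.
by apply: eq_bigr => i _; rewrite rV_consS.
Qed.

Lemma integral_gauss1 (a m : R) : 0 < a ->
  (\int[leb]_x (expR (- (a * (x - m) ^+ 2)))%:E = (Num.sqrt (pi / a))%:E)%E.
Proof.
move=> a0.
(* The standard deviation for which the normal density is the integrand up to a constant. *)
pose s : R := Num.sqrt (2 * a)^-1.
have s2 : s ^+ 2 = (2 * a)^-1 by rewrite sqr_sqrtr// invr_ge0; lra.
have s0 : s != 0 by rewrite sqrtr_eq0 -ltNge invr_gt0; lra.
have := integral_normal_pdf m s.
rewrite (normal_pdfE _ s0).
have ma : measurable_fun setT (fun x : R => (expR (- (a * (x - m) ^+ 2)))%:E).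
  apply/measurable_EFinP; apply: measurableT_comp => //.
  apply: measurableT_comp => //; apply: measurable_funM => //.
  by apply: measurable_funX; exact: measurable_funB.
have sqa : Num.sqrt (pi / a) != 0 by rewrite sqrtr_eq0 -ltNge divr_gt0// pi_gt0.
rewrite (_ : (fun x => _) = fun x : R =>
    ((Num.sqrt (pi / a))^-1)%:E * (expR (- (a * (x - m) ^+ 2)))%:E)%E; last first.
  apply/funext => x; rewrite -EFinM /normal_peak /normal_fun; congr (_ * expR _)%:E.
    congr ((Num.sqrt _)^-1); rewrite s2; field; lra.
  rewrite s2 mulNr; field; lra.
rewrite ge0_integralZl//.
move=> /(congr1 (fun z => (Num.sqrt (pi / a))%:E * z)%E).
by rewrite muleA -EFinM divff// mul1e mule1.
Qed.

(** Completes the square about the weighted barycenter. The remainder is written with the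
    differences [p i - p j] so that Gaussian integrals depend on mutual distances only. *)
Lemma sum_weighted_sqr N (a p : 'I_N -> R) (x : R) : 0 < \sum_i a i ->
  \sum_i a i * (x - p i) ^+ 2 =
  (\sum_i a i) * (x - (\sum_i a i * p i) / \sum_i a i) ^+ 2
  + (\sum_i \sum_j a i * a j * (p i - p j) ^+ 2) / (2 * \sum_i a i).
Proof.
move=> A0; set A := \sum_i a i in A0 *.
set B := \sum_i a i * p i; pose C := \sum_i a i * p i ^+ 2.
have -> : \sum_i a i * (x - p i) ^+ 2 = A * x ^+ 2 - 2 * x * B + C.
  rewrite /A /B /C mulr_suml mulr_sumr -sumrB -big_split/=.
  by apply: eq_bigr => i _; ring.
have -> : \sum_i \sum_j a i * a j * (p i - p j) ^+ 2 = 2 * (A * C - B ^+ 2).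
  transitivity (\sum_i (a i * p i ^+ 2 * A - 2 * (a i * p i) * B + a i * C)).
    apply: eq_bigr => i _; rewrite /A /B /C !mulr_sumr -sumrB -big_split/=.
    by apply: eq_bigr => j _; ring.
  rewrite !big_split/= sumrN -!mulr_suml -mulr_sumr -/A -/B -/C; ring.
by field; lra.
Qed.

Lemma integral_gauss_rV n N (a : 'I_N -> R) (p : 'I_N -> 'rV[R]_n) :
  0 < \sum_i a i ->
  (\int[lebesgue_rV n]_x
     (expR (- \sum_i a i * sqdist x (p i)))%:E =
   (gauss_mass n a (fun i j => sqdist (p i) (p j)))%:E)%E.
Proof.
rewrite /gauss_mass /sqdist.
move=> A0; set A := \sum_i a i in A0 *.
pose e k := (\sum_i \sum_j a i * a j * (p i ord0 k - p j ord0 k) ^+ 2) / (2 * A).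
pose c k := (\sum_i a i * p i ord0 k) / A.
(* The factor of the integrand in coordinate [k], including its share [e k] of the remainder. *)
pose h k t := expR (- (A * (t - c k) ^+ 2)) * expR (- e k).
have mh k : measurable_fun setT (h k).
  apply: measurable_funM => //; apply: measurableT_comp => //.
  apply: measurableT_comp => //; apply: measurable_funM => //.
  by apply: measurable_funX; exact: measurable_funB.
transitivity (\int[lebesgue_rV n]_x (\prod_k h k (x ord0 k))%:E)%E.
  apply: eq_integral => x _; congr EFin.
  under [RHS]eq_bigr do rewrite /h -expRD.
  rewrite -expR_sum; congr expR.
  under eq_bigr do rewrite mulr_sumr.
  rewrite exchange_big/= -sumrN; apply: eq_bigr => k _.
  by rewrite sum_weighted_sqr// opprD.
rewrite ge0_integral_rV_prod//; last by move=> k t; rewrite mulr_ge0// expR_ge0.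
rewrite (eq_bigr (fun k => (Num.sqrt (pi / A) * expR (- e k))%:E)); last first.
  move=> k _; under eq_integral do rewrite /h EFinM.
  rewrite ge0_integralZr//; last first.
  - apply/measurable_EFinP; apply: measurableT_comp => //.
    apply: measurableT_comp => //; apply: measurable_funM => //.
    by apply: measurable_funX; exact: measurable_funB.
  by rewrite integral_gauss1.
rewrite prodEFin big_split/= prodr_const card_ord -expR_sum sumrN; congr (_ * expR (- _))%:E.
rewrite -mulr_suml; congr (_ / _).
rewrite exchange_big/=; apply: eq_bigr => i _; rewrite exchange_big/=.
by apply: eq_bigr => j _; rewrite mulr_sumr.
Qed.

End gauss.

(** * Integrals of products of exponential sums *)

Section expsum.
Context {R : realType} (N b : nat).
Hypothesis N0 : (0 < N)%N.
Variables (w : 'I_b -> R).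
Hypothesis w0 : forall k, 0 < w k.

Let wsum0 (k : {ffun 'I_N -> 'I_b}) : 0 < \sum_i w (k i).
Proof.
case: N N0 k => // m _ k; rewrite big_ord_recl ltr_wpDr//.
by apply: sumr_ge0 => i _; exact/ltW.
Qed.

(** The weights are fixed while the coefficients vary: minus the derivative is the same sum with
    coefficients [c k * w k]. *)
Definition expsum (c : 'I_b -> R) (u : R) : R := \sum_k c k * expR (- (w k * u)).

(** Expanding the product gives one Gaussian for each choice [k] of an exponential in every factor.
    The coefficients depend on the factor because a mixed derivative alters only two factors. *)
Lemma integral_prod_expsum n (c : 'I_N -> 'I_b -> R) (p : 'I_N -> 'rV[R]_n) :
  (\int[lebesgue_rV n]_x (\prod_i expsum (c i) (sqdist x (p i)))%:E =
   (\sum_(k : {ffun 'I_N -> 'I_b}) (\prod_i c i (k i)) *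
      gauss_mass n (fun i => w (k i)) (fun i j => sqdist (p i) (p j)))%:E)%E.
Proof.
pose g (k : {ffun 'I_N -> 'I_b}) (x : 'rV[R]_n) :=
  expR (- \sum_i w (k i) * sqdist x (p i)).
have mg k : measurable_fun setT (g k).
  apply: measurableT_comp => //; apply: measurableT_comp => //.
  apply: measurable_sum => i; apply: measurable_funM => //; exact: measurable_sqdist.
have Ig k : (\int[lebesgue_rV n]_x (g k x)%:E =
    (gauss_mass n (fun i => w (k i)) (fun i j => sqdist (p i) (p j)))%:E)%E.
  exact/integral_gauss_rV/wsum0.
have ig k : (lebesgue_rV n).-integrable setT (EFin \o g k).
  apply/integrableP; split; first by apply/measurable_EFinP; exact: mg.
  under eq_integral do rewrite /= ger0_norm ?expR_ge0//.
  by rewrite Ig ltry.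
transitivity (\int[lebesgue_rV n]_x
    \sum_(k : {ffun 'I_N -> 'I_b}) ((\prod_i c i (k i))%:E * (g k x)%:E))%E.
  apply: eq_integral => x _; rewrite bigA_distr_bigA/= -sumEFin.
  apply: eq_bigr => k _; rewrite big_split/= EFinM -expR_sum sumrN//.
rewrite integral_sum//; last by move=> k; apply: integrableZl => //; exact: ig.
rewrite -sumEFin; apply: eq_bigr => k _.
by rewrite (integralZl measurableT (ig k)) [X in (_ * X)%E]Ig.
Qed.

End expsum.

(** * Intersections of balls *)

Section kneser_poulsen_expsum.
Context {R : realType} (N b d : nat).
Hypotheses (N_gt0 : (0 < N)%N) (N_le : (N <= d + 3)%N).
Variables (w c : 'I_b -> R).
Hypothesis w_gt0 : forall k, 0 < w k.
Hypothesis expsum_ge0 : forall u, 0 <= u -> 0 <= expsum w c u.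
Hypothesis opp_dexpsum_ge0 : forall u, 0 <= u -> 0 <= expsum w (fun k => c k * w k) u.

Let C (k : {ffun 'I_N -> 'I_b}) := \prod_i c (k i).
Let v (k : {ffun 'I_N -> 'I_b}) i := w (k i).
Let Q (k : {ffun 'I_N -> 'I_b}) (D : 'I_N -> 'I_N -> R) :=
  (\sum_i \sum_j v k i * v k j * D i j) / (2 * \sum_i v k i).

Let v_gt0 k : 0 < \sum_i v k i.
Proof.
rewrite (bigD1 (Ordinal N_gt0))//= ltr_wpDr//; last by rewrite /v.
by apply: sumr_ge0 => i _; apply/ltW; exact: w_gt0.
Qed.

(** Trades two dimensions for the inverse of the total weight, which is the denominator that
    differentiating the exponent [Q] produces. *)
Let mass_SS n k D :
  gauss_mass (n + 2) (v k) D = pi / (\sum_i v k i) * gauss_mass n (v k) D.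
Proof.
rewrite /gauss_mass addn2 !exprS mulrA -expr2 sqr_sqrtr ?mulrA//.
by rewrite divr_ge0 ?pi_ge0// ltW.
Qed.

(* The sum is the integral over R^(d + 2) of the mixed second derivative of
   prod_l expsum (u_l) in u_i and u_j, at u_l = |x - y_l|^2. *)
Let mixed_ge0 (y : 'I_N -> 'rV[R]_(d + 2)) i j : i != j ->
  0 <= \sum_k C k * (v k i * v k j *
         gauss_mass (d + 2) (v k) (fun i j => sqdist (y i) (y j))).
Proof.
(* Factors [i] and [j] become minus the derivative of [expsum]; the two signs cancel, and every
   factor is nonnegative. *)
move=> ij; pose c' l k := c k * (if (l == i) || (l == j) then w k else 1).
have := integral_prod_expsum N_gt0 w_gt0 c' y.
rewrite [X in _ = X%:E](_ : _ = \sum_k C k * (v k i * v k j *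
         gauss_mass (d + 2) (v k) (fun i j => sqdist (y i) (y j)))); last first.
  apply: eq_bigr => k _; rewrite mulrA; congr (_ * _).
  rewrite big_split/=; congr (_ * _); rewrite -big_mkcond/= (bigD1 i) ?eqxx//=.
  rewrite (big_pred1 j)// => l; case: (eqVneq l i) => [->|]//=.
    by rewrite (negbTE ij).
  by rewrite andbT.
rewrite -lee_fin => <-; apply: integral_ge0 => x _; rewrite lee_fin.
apply: prodr_ge0 => l _; rewrite /c'.
case: (_ || _); first exact/opp_dexpsum_ge0/sqdist_ge0.
under [X in expsum w X]eq_fun do rewrite mulr1.
exact/expsum_ge0/sqdist_ge0.
Qed.

Theorem kneser_poulsen_expsum (p q : 'I_N -> 'rV[R]_d) :
  (forall i j, sqdist (q i) (q j) <= sqdist (p i) (p j)) ->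
  (\int[lebesgue_rV d]_x (\prod_i expsum w c (sqdist x (p i)))%:E <=
   \int[lebesgue_rV d]_x (\prod_i expsum w c (sqdist x (q i)))%:E)%E.
Proof.
move=> qp; rewrite !(integral_prod_expsum N_gt0 w_gt0 (fun=> c)) lee_fin.
pose D0 i j := sqdist (p i) (p j); pose D1 i j := sqdist (q i) (q j).
pose E i j := D1 i j - D0 i j.
(* For intermediate [t] this matrix need not come from points of R^d; it is the formula
   [gauss_mass d] that is followed along the segment. *)
pose D t i j := (1 - t) * D0 i j + t * D1 i j.
have QD k t : Q k (D t) = Q k D0 + t * Q k E.
  rewrite /Q [t * _]mulrA -mulrDl [t * \sum_i _]mulr_sumr -big_split/=; congr (_ / _).
  apply: eq_bigr => i _; rewrite [t * \sum_j _]mulr_sumr -big_split/=; apply: eq_bigr => j _.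
  by rewrite /D /E; ring.
pose a k := Num.sqrt (pi / \sum_i v k i) ^+ d.
pose F t := \sum_k C k * (a k * expR (- (Q k D0 + t * Q k E))).
pose dF t := \sum_k C k * (a k * (- Q k E * expR (- (Q k D0 + t * Q k E)))).
have FE t : F t = \sum_k C k * gauss_mass d (v k) (D t).
  by apply: eq_bigr => k _; rewrite /gauss_mass -/(Q k (D t)) QD.
(* The 2 is the denominator in [Q], as the double sum meets each pair twice; the [pi] comes from
   [mass_SS]. *)
have dFE t : dF t = \sum_i \sum_j (- E i j) / (2 * pi) *
    \sum_k C k * (v k i * v k j * gauss_mass (d + 2) (v k) (D t)).
  transitivity (\sum_k \sum_i \sum_j (- E i j) / (2 * pi) *
      (C k * (v k i * v k j * gauss_mass (d + 2) (v k) (D t)))).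
    apply: eq_bigr => k _.
    rewrite {1}/Q -mulNr -sumrN 2!mulr_suml 2!mulr_sumr.
    apply: eq_bigr => i _; rewrite -sumrN 2!mulr_suml 2!mulr_sumr.
    apply: eq_bigr => j _.
    rewrite mass_SS /gauss_mass -/(Q k (D t)) QD -/(a k).
    move: (pi : R) (\sum_l v k l) (pi_gt0 R) (v_gt0 k) => P W P0 W0.
    by field; rewrite !gt_eqF.
  rewrite exchange_big/=; apply: eq_bigr => i _; rewrite exchange_big/=.
  by apply: eq_bigr => j _; rewrite mulr_sumr.
have dF_ge0 t : 0 <= t <= 1 -> 0 <= dF t.
  move=> t01; have [y yE] := sqdist_convex_realization p q N_le t01.
  rewrite dFE; apply: sumr_ge0 => i _; apply: sumr_ge0 => j _.
  (* Only off-diagonal terms are mixed derivatives; on the diagonal [E] vanishes. *)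
  have [<-|ij] := eqVneq i j.
    by rewrite /E /D0 /D1 !sqdistxx subrr oppr0 !mul0r.
  apply: mulr_ge0.
    rewrite divr_ge0 ?mulr_ge0 ?pi_ge0// oppr_ge0 subr_le0; exact: qp.
  have -> : D t = fun i j => sqdist (y i) (y j).
    by apply/funext => i'; apply/funext => j'; rewrite yE.
  exact: mixed_ge0.
have F_derive (t : R) : is_derive t 1 F (dF t).
  have -> : F = \sum_k (fun t => C k * (a k * expR (- (Q k D0 + t * Q k E)))).
    by apply/funext => s; rewrite fct_sumE.
  apply: (big_ind2 (fun (f : R -> R) (l : R) => is_derive t 1 f l)).
  - exact: is_derive_cst.
  - by move=> f l g m; exact: is_deriveD.
  move=> k _.
  have lin : is_derive t 1 (fun s => - (Q k D0 + s * Q k E)) (- Q k E).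
    have -> : (fun s => - (Q k D0 + s * Q k E)) =
        ((- Q k E) \*: (@id R)) - cst (Q k D0).
      apply/funext => s; rewrite -[RHS]/(- Q k E * s - Q k D0); ring.
    by apply: is_derive_eq; rewrite subr0 /GRing.scale/= mulr1.
  have -> : (fun t => C k * (a k * expR (- (Q k D0 + t * Q k E)))) =
      (C k * a k) \*: (expR \o (fun t => - (Q k D0 + t * Q k E))).
    by apply/funext => s /=; rewrite mulrA.
  apply: is_derive_eq.
  rewrite -[LHS]/(C k * a k * (expR (- (Q k D0 + t * Q k E)) * - Q k E)); ring.
have : 0 <= F 1 - F 0.
  have [|t /andP[t0 t1] ->] := @MVT R F dF 0 1 ltr01 (fun t _ => F_derive t) _.
    apply: continuous_subspaceT => t; apply: differentiable_continuous.
    by apply/derivable1_diffP; apply: ex_derive.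
  by rewrite subr0 mulr1 dF_ge0// !ltW.
rewrite subr_ge0 !FE.
have -> : D 0 = D0.
  by apply/funext => i; apply/funext => j; rewrite /D subr0 mul1r mul0r addr0.
have -> // : D 1 = D1.
by apply/funext => i; apply/funext => j; rewrite /D subrr mul0r mul1r add0r.
Qed.

End kneser_poulsen_expsum.

(** * Approximation of the indicator of [0, 1[ by sums of exponentials *)

Section soft_step.
Context {R : realType}.
Implicit Types (m : nat) (u : R).

(* The exponents are such that [2 ^ (m ^ 2) * expR (- soft_rate m * u)]
   tends to +oo for [u < 1] and to 0 for [1 <= u]. *)
Definition soft_exp m : nat := 2 ^ (m ^ 2).
Definition soft_rate m : R := ln 2 * (m ^ 2 + m)%:R.
(** Of the form [1 - (1 - y) ^+ n]: close to 1 when [n y] is large, to 0 when [n y] is small, and a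
    polynomial in the exponential [y]. *)
Definition soft_step m u : R :=
  1 - (1 - expR (- (soft_rate m * u))) ^+ soft_exp m.

(** Data of the binomial expansion of [soft_step]. Its constant term cancels, so powers start at 1
    and the weights are positive once [0 < m]. *)
Definition soft_weight m (k : 'I_(soft_exp m)) : R := soft_rate m * k.+1%:R.
Definition soft_coef m (k : 'I_(soft_exp m)) : R :=
  (-1) ^+ k * 'C(soft_exp m, k.+1)%:R.

Let ln2_gt0 : 0 < ln 2 :> R.
Proof. by apply: ln_gt0; lra. Qed.

Let ln2_ge0 : 0 <= ln 2 :> R.
Proof. exact/ltW. Qed.

Lemma soft_rate_gt0 m : (0 < m)%N -> 0 < soft_rate m.
Proof. by move=> m0; rewrite mulr_gt0// ltr0n addn_gt0 m0 orbT. Qed.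

Lemma soft_exp_gt0 m : (0 < soft_exp m)%N.
Proof. by rewrite expn_gt0. Qed.

Let weightE m (k : 'I_(soft_exp m)) u :
  expR (- (soft_weight k * u)) = expR (- (soft_rate m * u)) ^+ k.+1.
Proof. by rewrite -expRM_natr; congr expR; rewrite /soft_weight; ring. Qed.

Lemma soft_step_expsum m u :
  soft_step m u = expsum (@soft_weight m) (@soft_coef m) u.
Proof.
rewrite /soft_step exprBn big_ord_recl/= !expr0 expr1n !mul1r bin0 mulr1n opprD addNKr.
rewrite -sumrN; apply: eq_bigr => k _.
rewrite weightE /soft_coef expr1n mulr1 /bump leq0n add1n exprS -mulr_natr; ring.
Qed.

(** The left side is minus the derivative of [soft_step m]; the absorption identity for binomials
    factors it, which exposes its sign for [0 <= u]. *)
Lemma soft_step_dexpsum m u :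
  expsum (@soft_weight m) (fun k => soft_coef k * soft_weight k) u =
  soft_rate m * (soft_exp m)%:R * expR (- (soft_rate m * u)) *
    (1 - expR (- (soft_rate m * u))) ^+ (soft_exp m).-1.
Proof.
rewrite /expsum exprBn mulr_sumr.
under eq_bigr do rewrite weightE /soft_coef /soft_weight.
move: (soft_exp_gt0 m); case: (soft_exp m) => // b _; apply: eq_bigr => k _ /=.
rewrite expr1n mulr1 exprS -mulr_natr.
have : k.+1%:R * 'C(b.+1, k.+1)%:R = b.+1%:R * 'C(b, k)%:R :> R.
  by rewrite -!natrM mul_bin_diag.
set x := 'C(b.+1, k.+1)%:R; set y := 'C(b, k)%:R => xy.
transitivity ((-1) ^+ k * (k.+1%:R * x) * soft_rate m *
  (expR (- (soft_rate m * u)) * expR (- (soft_rate m * u)) ^+ k)); first ring.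
by rewrite xy; ring.
Qed.

Let y_itv m u : 0 <= u -> 0 <= 1 - expR (- (soft_rate m * u)) <= 1.
Proof.
move=> u0; rewrite subr_ge0 gerBl expR_ge0 andbT -expR0 ler_expR oppr_le0.
by rewrite !mulr_ge0// ln2_ge0.
Qed.

Lemma soft_step_itv m u : 0 <= u -> 0 <= soft_step m u <= 1.
Proof.
move=> /(y_itv m)/andP[y0 y1].
by rewrite /soft_step subr_ge0 gerBl exprn_ge0// andbT exprn_ile1.
Qed.

Lemma dsoft_step_ge0 m u : 0 <= u ->
  0 <= expsum (@soft_weight m) (fun k => soft_coef k * soft_weight k) u.
Proof.
move=> /(y_itv m)/andP[y0 _]; rewrite soft_step_dexpsum.
by rewrite !mulr_ge0 ?exprn_ge0 ?expR_ge0// ?ln2_ge0.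
Qed.

(** This is [n y]. Its base 2 logarithm is m^2 (1 - u) - m u, hence -m at u = 1: the limit indicator
    excludes 1. *)
Let z m u := expR (ln 2 * ((m ^ 2)%:R - (m ^ 2 + m)%:R * u)).

Let zE m u : (soft_exp m)%:R * expR (- (soft_rate m * u)) = z m u.
Proof.
rewrite /z mulrBr expRD -mulrN; congr (_ * expR _); last by rewrite /soft_rate; ring.
by rewrite expRM_natr lnK ?posrE// natrX.
Qed.

(** Bernoulli's inequality [1 - (1 - y) ^+ n <= n y], by induction on [n]. *)
Lemma soft_step_le m u : 0 <= u -> soft_step m u <= z m u.
Proof.
move=> /(y_itv m)/andP[y0 y1]; rewrite -zE /soft_step.
move: (expR _) y0 y1 => y y0 y1; elim: (soft_exp m) => [|n IHn].
  by rewrite expr0 subrr mul0r.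
rewrite -natr1 mulrDl mul1r exprSr.
have : (1 - y) ^+ n * y <= 1 * y by rewrite ler_wpM2r ?exprn_ile1//; lra.
lra.
Qed.

(** From [1 - y <= expR (- y)], then [expR (n y) >= 1 + n y]. *)
Lemma soft_step_ge m u : 0 <= u -> 1 - soft_step m u <= (z m u)^-1.
Proof.
move=> /(y_itv m)/andP[y0 y1]; rewrite -zE /soft_step.
set y := expR _ in y0 y1 *; set n := soft_exp m.
have ny0 : 0 < n%:R * y by rewrite mulr_gt0 ?expR_gt0// ltr0n soft_exp_gt0.
apply: (@le_trans _ _ (expR (- (n%:R * y)))).
  rewrite opprB addrCA subrr addr0 -mulrN expRM_natl; apply: lerXn2r.
  - by rewrite nnegrE.
  - by rewrite nnegrE expR_ge0.
  - exact: expR_ge1Dx.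
rewrite expRN lef_pV2 ?posrE ?expR_gt0//.
by apply: le_trans (expR_ge1Dx _); lra.
Qed.

(** The bound is uniform in [m] and Gaussian when [u] is a squared distance, as dominated
    convergence requires. It is at least 1 below u = 1, and dominates [z m u] beyond. *)
Lemma soft_step_gauss m u : (0 < m)%N -> 0 <= u ->
  soft_step m u <= expR (ln 2) * expR (- (ln 2 * u)).
Proof.
move=> m0 u0; have L0 := ln2_gt0; rewrite -expRD.
have [u1|u1] := leP 1 u.
  apply: le_trans (soft_step_le m u0) _; rewrite ler_expR natrD.
  have m1 : 1 <= m%:R :> R by rewrite ler1n.
  rewrite natrX (_ : ln 2 - ln 2 * u = ln 2 * (1 - u)); last ring.
  rewrite ler_wpM2l//; move: (m%:R : R) m1 => M M1.
  have M2 : 0 <= (M ^+ 2 - 1) * (u - 1) by rewrite mulr_ge0 ?subr_ge0// exprn_ege1.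
  have Mu : 0 <= M * u by nra.
  lra.
have /andP[_ s1] := soft_step_itv m u0; apply: le_trans s1 _.
rewrite -[X in X <= _]expR0 ler_expR subr_ge0 -[X in _ <= X]mulr1 ler_wpM2l//; lra.
Qed.

Lemma cvg_soft_step u : 0 <= u -> soft_step m u @[m --> \oo] --> ((u < 1)%R%:R : R).
Proof.
move=> u0; have L0 := ln2_gt0.
have half : (2^-1 : R) ^+ m @[m --> \oo] --> (0 : R).
  by apply: cvg_expr; rewrite ger0_norm; lra.
have halfE m : (2^-1 : R) ^+ m = expR (- (ln 2 * m%:R)).
  by rewrite -mulNr expRM_natr expRN lnK ?posrE.
have [u1|u1] := ltP u 1; last first.
  apply: (squeeze_cvgr _ (cvg_cst 0) half); near=> m.
  have /andP[-> _] /= := soft_step_itv m u0; apply: le_trans (soft_step_le m u0) _.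
  rewrite halfE ler_expR -[X in _ <= X]mulrN ler_wpM2l// natrD.
  have : 0 <= (m%:R ^+ 2 + m%:R) * (u - 1) :> R.
    by rewrite mulr_ge0 ?subr_ge0// addr_ge0// exprn_ge0.
  rewrite natrX; lra.
have h1 : 1 - (2^-1 : R) ^+ m @[m --> \oo] --> (1 : R).
  by rewrite -[X in _ --> X]subr0; apply: cvgB => //; exact: cvg_cst.
rewrite (_ : true%:R = 1 :> R)//; apply: squeeze_cvgr; [|exact: h1|exact: cvg_cst]; near=> m.
have /andP[_ ->] := soft_step_itv m u0; rewrite andbT lerBlDr -lerBlDl.
apply: le_trans (soft_step_ge m u0) _; rewrite halfE expRN lef_pV2 ?posrE ?expR_gt0//.
rewrite ler_expR ler_wpM2l// natrD natrX.
(* Past this threshold m^2 (1 - u) - m u is at least m, so the inverse of [z m u] is at most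
   2^-m. *)
have : (1 + u) / (1 - u) <= m%:R.
  by near: m; exact: nbhs_infty_ger.
rewrite ler_pdivrMr ?subr_gt0// => mu.
have : 0 <= m%:R * (m%:R * (1 - u) - (1 + u)) by rewrite mulr_ge0 ?subr_ge0.
lra.
Unshelve. all: by end_near. Qed.

End soft_step.

(** * Passage to the limit: from soft steps to balls *)

Section kneser_poulsen.
Context {R : realType} (N d : nat).
Hypotheses (N_gt0 : (0 < N)%N) (N_le : (N <= d + 3)%N).

(** Dominated convergence: the factor at [i0] lies below a fixed Gaussian and the others below 1.
    The index [m.+1] avoids [soft_step 0], whose rate is zero. *)
Lemma cvg_integral_soft_step (p : 'I_N -> 'rV[R]_d) :
  (\int[lebesgue_rV d]_x (\prod_i soft_step m.+1 (sqdist x (p i)))%:E)%E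
    @[m --> \oo] -->
  (\int[lebesgue_rV d]_x (\prod_i (sqdist x (p i) < 1)%R%:R)%:E)%E.
Proof.
pose i0 := Ordinal N_gt0.
pose g (x : 'rV[R]_d) : R := expR (ln 2) * expR (- (ln 2 * sqdist x (p i0))).
have L0 : 0 < ln 2 :> R by apply: ln_gt0; lra.
have ig : (lebesgue_rV d).-integrable setT (EFin \o g).
  rewrite (_ : _ \o _ = fun x => (expR (ln 2))%:E *
      (expR (- (ln 2 * sqdist x (p i0))))%:E)%E//.
  apply: integrableZl => //; apply/integrableP; split.
    apply/measurable_EFinP; apply: measurableT_comp => //.
    apply: measurableT_comp => //; apply: measurable_funM => //.
    exact: measurable_sqdist.
  under eq_integral do rewrite /= ger0_norm ?expR_ge0//.
  rewrite (eq_integral (fun x : 'rV[R]_d =>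
      (expR (- \sum_(i < 1) ln 2 * sqdist x (p i0)))%:E)); last first.
    by move=> x _; rewrite big_ord1.
  by rewrite (integral_gauss_rV (fun=> p i0)) ?ltry// big_ord1.
apply: (@dominated_cvg _ _ _ _ _ measurableT _ _ (EFin \o g)) => //.
- move=> m; apply/measurable_EFinP; apply: measurable_prod => i _.
  apply: (measurable_funB (measurable_cst _)); apply: measurable_funX.
  apply: (measurable_funB (measurable_cst _)); apply: measurableT_comp => //.
  apply: measurableT_comp => //; apply: measurable_funM => //.
  exact: measurable_sqdist.
- move=> x _; apply: (@cvg_EFin R _ _ _
      (fun m => (\prod_i soft_step m.+1 (sqdist x (p i)))%:E)).
    exact: nearW.
  rewrite /comp/=; elim: (index_enum _) => [|i s IHs].
    by under eq_fun do rewrite big_nil; rewrite big_nil; exact: cvg_cst.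
  under eq_fun do rewrite big_cons; rewrite big_cons; apply: cvgM => //.
  by rewrite (cvg_shiftS (soft_step ^~ (sqdist x (p i)))); exact/cvg_soft_step/sqdist_ge0.
move=> m x _ /=; rewrite lee_fin ger0_norm; last first.
  by apply: prodr_ge0 => i _; have /andP[] := soft_step_itv m.+1 (sqdist_ge0 x (p i)).
have u0 := sqdist_ge0 x (p i0); rewrite (bigD1 i0)//=.
apply: (le_trans _ (soft_step_gauss (ltn0Sn m) u0)).
have /andP[s0 _] := soft_step_itv m.+1 u0; apply: (ler_piMr s0).
by apply: prodr_ile1 => i _; exact/soft_step_itv/sqdist_ge0.
Qed.

Theorem kneser_poulsen_ball (p q : 'I_N -> 'rV[R]_d) :
  (forall i j, sqdist (q i) (q j) <= sqdist (p i) (p j)) ->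
  (\int[lebesgue_rV d]_x (\prod_i (sqdist x (p i) < 1)%R%:R)%:E <=
   \int[lebesgue_rV d]_x (\prod_i (sqdist x (q i) < 1)%R%:R)%:E)%E.
Proof.
move=> qp.
have cp := @cvg_integral_soft_step p; have cq := @cvg_integral_soft_step q.
have hp := cvg_lim (@ereal_hausdorff R) cp; have hq := cvg_lim (@ereal_hausdorff R) cq.
rewrite -[leLHS]hp -[leRHS]hq.
apply: lee_lim; [exact: cvgP cp|exact: cvgP cq|].
apply: nearW => m.
under eq_integral do under eq_bigr do rewrite soft_step_expsum.
under [leRHS]eq_integral do under eq_bigr do rewrite soft_step_expsum.
apply: kneser_poulsen_expsum => //.
- by move=> k; rewrite mulr_gt0// soft_rate_gt0.
- by move=> u u0; rewrite -soft_step_expsum; have /andP[] := soft_step_itv m.+1 u0.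
- by move=> u; exact: dsoft_step_ge0.
Qed.

End kneser_poulsen.

(** * Measurability and translations *)

Section contraction.
Context {R : realType} (n : nat).

Lemma euclidean_normB (x y : 'rV[R]_n) : euclidean_norm (x - y) = Num.sqrt (sqdist x y).
Proof. by congr Num.sqrt; apply: eq_bigr => k _; rewrite !mxE. Qed.

Lemma contraction_sqdist (T : 'rV[R]_n -> 'rV[R]_n) : euclidean_contraction T ->
  forall x y, sqdist (T x) (T y) <= sqdist x y.
Proof.
by move=> cT x y; have := cT x y; rewrite !euclidean_normB ler_psqrt ?nnegrE ?sqdist_ge0.
Qed.

Lemma rat_approx (x : 'rV[R]_n) (e : R) : 0 < e ->
  exists q : 'rV[rat]_n, sqdist x (map_mx ratr q) < e ^+ 2.
Proof.
move=> e0; have n0 : 0 < n.+1%:R :> R by rewrite ltr0n.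
pose dl := e / n.+1%:R; have dl0 : 0 < dl by rewrite divr_gt0.
have H k : exists r : rat, `|x ord0 k - ratr r| < dl.
  have /rat_in_itvoo[r] : x ord0 k - dl < x ord0 k + dl by lra.
  by rewrite in_itv/= => /andP[r1 r2]; exists r; rewrite ltr_norml; apply/andP; split; lra.
exists (\row_k projT1 (cid (H k))).
apply: (@le_lt_trans _ _ (\sum_(k < n) dl ^+ 2)).
  apply: ler_sum => k _; rewrite !mxE; case: cid => r /= /ltW rdl.
  by rewrite -real_normK ?num_real// lerXn2r ?nnegrE// ltW.
rewrite sumr_const card_ord -mulr_natl /dl expr_div_n mulrA ltr_pdivrMr ?exprn_gt0//.
rewrite mulrC ltr_pM2l ?exprn_gt0// -natrX ltr_nat.
by rewrite -mulnn; apply: leq_trans (leq_addr _ _).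
Qed.

(** A coordinate [g] of [T] is 1-Lipschitz, so it exceeds [c] on the ball of radius [g q - c] about
    any rational point [q] with [c < g q]; countably many such balls exhaust the preimage of ]c,
    +oo[. *)
Lemma measurable_contraction (T : 'rV[R]_n -> 'rV[R]_n) :
  euclidean_contraction T -> measurable_fun setT T.
Proof.
move=> /contraction_sqdist cT; apply/measurable_fun_rVP => i.
pose g x := T x ord0 i; rewrite -[X in measurable_fun _ X]/g.
have gT x y : `|g x - g y| ^+ 2 <= sqdist x y.
  apply: le_trans (cT x y); rewrite real_normK ?num_real//.
  by rewrite /sqdist (bigD1 i)//= lerDl sumr_ge0// => k _; exact: sqr_ge0.
move=> mD; apply: (measurability _ (RGenOInfty.measurableE R)) => //.
move=> /= _ [_ [c ->] <-]; rewrite preimage_itvoy setTI.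
rewrite [X in measurable X](_ : _ = \bigcup_(q : 'rV[rat]_n)
  [set x | c < g (map_mx ratr q) /\ sqdist x (map_mx ratr q) < (g (map_mx ratr q) - c) ^+ 2]).
  apply: countable_bigcupT_measurable => [|q]; first exact: countableP.
  have [cq|cq] := ltP c (g (map_mx ratr q)); last first.
    rewrite [X in measurable X](_ : _ = set0)//.
    by apply/seteqP; split => // x [].
  rewrite [X in measurable X](_ : _ =
      (fun x => sqdist x (map_mx ratr q)) @^-1` `]-oo, (g (map_mx ratr q) - c) ^+ 2[%classic).
    rewrite -[X in measurable X]setTI.
    by apply: measurable_sqdist; [exact: measurableT|exact: measurable_itv].
  by apply/seteqP; split => x /=; rewrite in_itv/=; [case|].
apply/seteqP; split => [x /= cx|x [q _ [/= cq xq]]].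
  (* If [q] is within half the gap of [x], then [g q - c] still exceeds half the gap, so the ball
     about [q] contains [x]. *)
  have e0 : 0 < (g x - c) / 2 by lra.
  have [q xq] := rat_approx x e0; exists q => //=.
  have : `|g x - g (map_mx ratr q)| < (g x - c) / 2.
    rewrite -(@ltr_pXn2r _ 2) ?nnegrE//; last exact/ltW.
    exact: le_lt_trans (gT _ _) xq.
  rewrite ltr_norml => /andP[g1 g2]; split; first lra.
  apply: lt_le_trans xq _; rewrite lerXn2r ?nnegrE//; lra.
have : `|g x - g (map_mx ratr q)| < g (map_mx ratr q) - c.
  rewrite -(@ltr_pXn2r _ 2) ?nnegrE//; last lra.
  exact: le_lt_trans (gT _ _) xq.
by rewrite ltr_norml => /andP[g1 g2]; lra.
Qed.

End contraction.

Section translation.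
Context {R : realType}.

Lemma ge0_integral_shift (c : R) (f : R -> \bar R) :
  measurable_fun setT f -> (forall x, (0 <= f x)%E) ->
  (\int[lebesgue_measure]_x f (c + x)%R = \int[lebesgue_measure]_x f x)%E.
Proof.
move=> mf f0.
pose h : measurableTypeR R -> measurableTypeR R := fun x => (c + x)%R.
have mh : measurable_fun setT h by exact: measurable_funD.
have := @ge0_integral_pushforward _ _ (measurableTypeR R) (measurableTypeR R) R h mh
  lebesgue_measure setT f measurableT mf (fun y _ => f0 y).
rewrite preimage_setT => <-.
apply: eq_measure_integral => /= A mA _.
apply/esym/lebesgue_measure_unique => //= _ [[a b]] _ <-.
rewrite /pushforward (_ : h @^-1` _ = `]a - c, b - c]%classic).
  rewrite !lebesgue_measure_itv/= !lte_fin ltrBlDr subrK.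
  by case: ifP => // _; rewrite -!EFinB; congr (_%:E); ring.
by apply/seteqP; split => x; rewrite /h /= !in_itv/= ltrBlDl lerBrDl.
Qed.

Lemma ge0_integral_rV_shift n (c : 'rV[R]_n) (f : 'rV[R]_n -> \bar R) :
  measurable_fun setT f -> (forall x, (0 <= f x)%E) ->
  (\int[lebesgue_rV n]_x f (c + x)%R = \int[lebesgue_rV n]_x f x)%E.
Proof.
have mshift m (y : 'rV[R]_m) : measurable_fun setT (fun x => y + x).
  apply/measurable_fun_rVP => i; under eq_fun do rewrite mxE.
  by apply: measurable_funD => //; exact: measurable_coord.
elim: n c f => [|n IHn] c f mf f0.
  by apply: eq_integral => x _; congr f; apply/rowP => -[].
rewrite !ge0_integral_rVS//; last first.
  exact: (measurableT_comp mf (mshift _ _)).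
have mfc t : measurable_fun setT (fun v => f (rV_cons (t, v))).
  apply: measurableT_comp mf _; apply: measurableT_comp (@measurable_rV_cons R n) _.
  exact: pair1_measurable.
transitivity (\int[lebesgue_measure]_t \int[lebesgue_rV n]_v
    f (rV_cons ((c ord0 ord0 + t)%R, v)))%E.
  apply: eq_integral => t _.
  rewrite -[RHS](IHn (rV_uncons c).2)//.
  apply: eq_integral => v _; congr f; apply/rowP => i; rewrite [(c + _) ord0 i]mxE.
  have [j ->|->] := unliftP ord0 i; last by rewrite !rV_cons0.
  rewrite !rV_consS/= !mxE. congr (c ord0 _ + _); exact: val_inj.
rewrite (@ge0_integral_shift _ (fun t => \int[lebesgue_rV n]_v f (rV_cons (t, v)))%E)//.
  apply: (@measurable_fun_fubini_tonelli_F _ _ (measurableTypeR R) _ _ _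
    (f \o @rV_cons R n)) => //.
    by apply: measurableT_comp mf _; exact: measurable_rV_cons.
  by move=> x; exact: f0.
by move=> x; apply: integral_ge0.
Qed.

End translation.

(** * Powers of densities *)

(** The integral of a nonnegative function is a supremum over the simple functions below it; this
    compares nested integrals without studying the measurability of the inner ones. *)
Lemma ge0_le_integralT (R : realType) d (T : measurableType d)
    (mu : {measure set T -> \bar R}) (f g : T -> \bar R) :
  (forall x, (0 <= f x <= g x)%E) -> (\int[mu]_x f x <= \int[mu]_x g x)%E.
Proof.
move=> fg; have f0 x : (0 <= f x)%E by have /andP[] := fg x.
have g0 x : (0 <= g x)%E by have /andP[] := fg x; exact: le_trans.
rewrite !ge0_integralTE//; apply: le_ereal_sup => _ [h hf <-]; exists h => // x.
by apply: le_trans (hf x) _; have /andP[] := fg x.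
Qed.

Section iterated_integral.
Context {R : realType} {dO : measure_display} {Omega : measurableType dO}.
Variable P : probability Omega R.

(** Expectation over [k] independent copies of [Omega], as nested integrals instead of a product
    space. *)
Fixpoint iterated_integral k (h : seq Omega -> \bar R) : \bar R :=
  if k is k'.+1 then (\int[P]_w iterated_integral k' (fun s => h (w :: s)))%E
  else h [::].

Lemma iterated_integral_ge0 k h : (forall s, (0 <= h s)%E) ->
  (0 <= iterated_integral k h)%E.
Proof.
by elim: k h => //= k IHk h h0; apply: integral_ge0 => w _; exact: IHk.
Qed.

Lemma le_iterated_integral k h1 h2 :
  (forall s, (0 <= h1 s)%E) -> (forall s, size s = k -> (h1 s <= h2 s)%E) ->
  (iterated_integral k h1 <= iterated_integral k h2)%E.
Proof.
elim: k h1 h2 => [|k IHk] h1 h2 h0 h12 /=; first exact: h12.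
apply: ge0_le_integralT => w; rewrite iterated_integral_ge0//=.
by apply: IHk => // s sk; apply: h12; rewrite /= sk.
Qed.

(** Tonelli, applied [k] times. The function [g] serves the induction: it absorbs the factors
    [phi x w] of the outcomes already fixed. *)
Lemma iterated_integral_prod d1 (T : measurableType d1)
    (mu : {sigma_finite_measure set T -> \bar R})
    (phi : T -> Omega -> R) (f g : T -> R) k :
  measurable_fun setT (fun z : T * Omega => phi z.1 z.2) ->
  (forall x w, 0 <= phi x w) -> measurable_fun setT g -> (forall x, 0 <= g x) ->
  (forall x, \int[P]_w (phi x w)%:E = (f x)%:E)%E ->
  (iterated_integral k (fun s => \int[mu]_x (g x * \prod_(w <- s) phi x w)%:E) =
   \int[mu]_x (g x * f x ^+ k)%:E)%E.
Proof.
move=> mphi phi0 mg g0 fE.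
have f0 x : 0 <= f x by rewrite -lee_fin -fE integral_ge0// => w _; rewrite lee_fin.
have mphi1 x : measurable_fun setT (phi x).
  exact: (measurableT_comp mphi (pair1_measurable x)).
have mf : measurable_fun setT f.
  apply/measurable_EFinP; rewrite (_ : _ \o _ = fun x => \int[P]_w (phi x w)%:E)%E; last first.
    by apply/funext => x; rewrite fE.
  apply: (@measurable_fun_fubini_tonelli_F _ _ _ _ _ P (fun z => (phi z.1 z.2)%:E)).
    exact/measurable_EFinP.
  by move=> z; rewrite lee_fin.
elim: k g mg g0 => [|k IHk] g mg g0 /=.
  by apply: eq_integral => x _; rewrite big_nil expr0.
transitivity (\int[P]_w \int[mu]_x (g x * phi x w * f x ^+ k)%:E)%E.
  apply: eq_integral => w _; rewrite -(IHk (fun x => g x * phi x w)); last 2 first.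
  - apply: measurable_funM => //.
    exact: (measurableT_comp mphi (pair2_measurable w)).
  - by move=> x; rewrite mulr_ge0.
  congr iterated_integral; apply/funext => s; apply: eq_integral => x _.
  by rewrite big_cons mulrA.
rewrite -(@fubini_tonelli _ _ _ _ _ mu P
    (fun z => (g z.1 * phi z.1 z.2 * f z.1 ^+ k)%:E))/=; last 2 first.
- apply/measurable_EFinP; apply: measurable_funM; first apply: measurable_funM => //.
  + exact: measurableT_comp.
  + by apply: measurable_funX; exact: measurableT_comp.
- by move=> z; rewrite lee_fin !mulr_ge0// exprn_ge0.
apply: eq_integral => x _.
under eq_integral do rewrite mulrAC EFinM.
rewrite ge0_integralZl//; last 3 first.
- exact/measurable_EFinP.
- by move=> w _; rewrite lee_fin.
- by rewrite lee_fin mulr_ge0// exprn_ge0.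
by rewrite fE -EFinM exprSr mulrA.
Qed.

End iterated_integral.

(** * Density of the sum with a uniform vector on the ball *)

Section density.
Context {R : realType} {dO : measure_display} {Omega : measurableType dO}.
Context {P : probability Omega R} {d : nat}.

Lemma integral_density_powR (Y : Omega -> 'rV[R]_d) (f g : 'rV[R]_d -> R) (a : R) :
  is_density P Y f -> is_density P Y g ->
  (\int[lebesgue_rV d]_x (f x `^ a)%:E = \int[lebesgue_rV d]_x (g x `^ a)%:E)%E.
Proof.
move=> [mf f0 fE] [mg g0 gE].
have mpow (h : 'rV[R]_d -> R) : measurable_fun setT h ->
    measurable_fun setT (fun x => (h x `^ a)%:E).
  by move=> mh; apply/measurable_EFinP; apply: measurableT_comp (measurable_powR a) mh.
apply: ge0_ae_eq_integral => //.
- exact: mpow.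
- exact: mpow.
- by move=> x _; rewrite lee_fin powR_ge0.
- by move=> x _; rewrite lee_fin powR_ge0.
have fg : ae_eq (lebesgue_rV d) setT (EFin \o f) (EFin \o g).
  apply: integral_ae_eq => //.
  - apply/integrableP; split; first exact/measurable_EFinP.
    under eq_integral do rewrite /= ger0_norm//.
    by rewrite -fE// preimage_setT probability_setT ltry.
  - by apply/measurable_EFinP; exact: mg.
  - by move=> A _ mA; rewrite -fE// -gE.
apply: filterS fg => x /(_ I) [fgx] _.
by rewrite fgx.
Qed.

(** If the volume were zero or infinite, the quotient in [uniform_on] would be 0 at [setT], where
    the probability is 1. *)
Lemma uniform_on_volume (W : Omega -> 'rV[R]_d) B : measurable B ->
  uniform_on P W B -> exists2 v : R, 0 < v & lebesgue_rV d B = v%:E.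
Proof.
move=> mB /(_ setT measurableT); rewrite preimage_setT probability_setT setTI.
have : (0 <= lebesgue_rV d B)%E by exact: measure_ge0.
case: (lebesgue_rV d B) => [r|_|//]; last by rewrite invey mule0 => /eqP; rewrite onee_eq0.
rewrite lee_fin le_eqVlt => /predU1P[<-|r0 _]; last by exists r.
by rewrite mul0e => /eqP; rewrite onee_eq0.
Qed.

Lemma unit_ballE : @euclidean_unit_ball R d = [set x | sqdist x 0 < 1].
Proof.
apply/seteqP; split => x; rewrite /euclidean_unit_ball /=;
    rewrite -[x in euclidean_norm x]subr0 euclidean_normB.
  by rewrite -{1}(@sqrtr1 R) ltr_sqrt.
by rewrite -{2}(@sqrtr1 R) ltr_sqrt.
Qed.

Lemma measurable_unit_ball : measurable (@euclidean_unit_ball R d).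
Proof.
rewrite unit_ballE -[X in measurable X]setTI.
rewrite (_ : [set x | _] = (fun x => sqdist x 0) @^-1` `]-oo, 1[%classic); last first.
  by apply/seteqP; split => x /=; rewrite in_itv.
by apply: (@measurable_sqdist R d 0) => //; exact: measurable_itv.
Qed.

Section sum_density.
Variables (Y W : {RV P >-> 'rV[R]_d}).
Hypothesis uW : uniform_on P W (@euclidean_unit_ball R d).
Hypothesis YW : independent_RV P Y W.

Let phi (x : 'rV[R]_d) (w : Omega) : R := (sqdist x (Y w) < 1)%R%:R.

Lemma measurable_ball_kernel :
  measurable_fun setT (fun z : 'rV[R]_d * Omega => phi z.1 z.2).
Proof.
apply: (@measurableT_comp _ _ _ _ _ _ (fun c : bool => c%:R : R)) => //.
apply: measurable_fun_ltr => //; apply: measurable_sum => k.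
apply: measurable_funX; apply: measurable_funB.
  exact: (measurableT_comp (measurable_coord k) measurable_fst).
apply: (measurableT_comp (measurable_coord k)).
exact: (measurableT_comp (measurable_funPT Y) measurable_snd).
Qed.

Definition ball_mass (x : 'rV[R]_d) : R := fine (\int[P]_w (phi x w)%:E)%E.

Lemma ball_massE x : (\int[P]_w (phi x w)%:E = (ball_mass x)%:E)%E.
Proof.
rewrite fineK// ge0_fin_numE; last by apply: integral_ge0 => w _; rewrite lee_fin.
apply: (@le_lt_trans _ _ (\int[P]_w 1)%E); last first.
  by rewrite integral_cst// mul1e; exact: le_lt_trans (probability_le1 P measurableT) (ltry _).
apply: (@ge0_le_integralT _ _ _ P (fun w => (phi x w)%:E) (fun=> 1%E)) => w.
rewrite !lee_fin ler0n/= /phi.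
by case: (_ < _).
Qed.


Lemma ball_mass_ge0 x : 0 <= ball_mass x.
Proof. by rewrite fine_ge0// integral_ge0// => w _; rewrite lee_fin. Qed.

Lemma measurable_ball_mass : measurable_fun setT ball_mass.
Proof.
apply/measurable_EFinP.
rewrite (_ : _ \o _ = fun x => \int[P]_w (phi x w)%:E)%E; last first.
  by apply/funext => x; rewrite ball_massE.
apply: (@measurable_fun_fubini_tonelli_F _ _ _ _ _ P (fun z => (phi z.1 z.2)%:E)).
  by apply/measurable_EFinP; exact: measurable_ball_kernel.
by move=> z; rewrite lee_fin.
Qed.

Let measurable_pair_RV : measurable_fun setT (fun w => (Y w, W w)).
Proof. by apply/measurable_fun_pair => /=; exact: measurable_funPT. Qed.

Let pair_RV : {RV P >-> ('rV[R]_d * 'rV[R]_d)%type} :=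
  HB.pack (fun w => (Y w, W w))
    (isMeasurableFun.Build _ _ _ _ (fun w => (Y w, W w)) measurable_pair_RV).

(** By independence the law of the pair agrees with the product law on rectangles, hence everywhere;
    the product measure is then an integral of sections. *)
Lemma independent_product (S : set ('rV[R]_d * 'rV[R]_d)) : measurable S ->
  P [set w | S (Y w, W w)] = (\int[P]_w P [set z | S (Y w, W z)])%E.
Proof.
move=> mS.
transitivity ((distribution P Y \x distribution P W)%E S).
  symmetry; apply: (@product_measure_unique _ _ _ _ _ _ _ (distribution P pair_RV)) => //.
rewrite /product_measure1 ge0_integral_distribution//; last exact: measurable_fun_xsection.
apply: eq_integral => w _ /=; rewrite /distribution /pushforward; congr (P _).
by apply/seteqP; split => z /=; rewrite /xsection/= inE.
Qed.

(** With [Y w] frozen, the uniform law gives the normalized volume of [A] intersected with the unit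
    ball about [Y w]; Tonelli then averages over [w] first. *)
Lemma is_density_sum (v : R) : 0 < v ->
  lebesgue_rV d (@euclidean_unit_ball R d) = v%:E ->
  is_density P (fun w => Y w + W w) (fun x => v^-1 * ball_mass x).
Proof.
move=> v0 vE; split.
- by apply: measurable_funM => //; exact: measurable_ball_mass.
- by move=> x; rewrite mulr_ge0 ?ball_mass_ge0// invr_ge0 ltW.
move=> A mA.
have madd : measurable_fun setT (fun z : 'rV[R]_d * 'rV[R]_d => z.1 + z.2).
  apply/measurable_fun_rVP => i; under eq_fun do rewrite mxE.
  apply: measurable_funD; apply: (measurableT_comp (measurable_coord i)) => //.
have mS : measurable [set z : 'rV[R]_d * 'rV[R]_d | A (z.1 + z.2)].
  by rewrite -[X in measurable X]setTI; exact: madd.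
rewrite [LHS](independent_product mS)/=.
have mphi w : measurable_fun setT (phi ^~ w).
  exact: (measurableT_comp measurable_ball_kernel (pair2_measurable w)).
have m1A : measurable_fun setT (\1_A : 'rV[R]_d -> R) by exact: measurable_indic.
transitivity (\int[P]_w \int[lebesgue_rV d]_x (v^-1 * \1_A x * phi x w)%:E)%E.
  apply: eq_integral => w _.
  have mAw : measurable [set z | A (Y w + z)].
    rewrite -[X in measurable X]setTI.
    exact: (measurableT_comp madd (pair1_measurable (Y w))).
  have -> := uW mAw; rewrite vE inver gt_eqF// muleC.
  rewrite -[X in (_ * lebesgue_rV d X)%E]setIT -integral_indic//; last first.
    by apply: measurableI => //; exact: measurable_unit_ball.
  transitivity (v^-1%:E * \int[lebesgue_rV d]_z (\1_A (Y w + z) * phi (Y w + z) w)%:E)%E.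
    congr (_ * _)%E; apply: eq_integral => z _; congr EFin.
    rewrite indicI !indicE; congr (_ * _).
    rewrite unit_ballE /phi; congr (nat_of_bool _)%:R.
    have -> : sqdist (Y w + z) (Y w) = sqdist z 0.
      by apply: eq_bigr => i _; rewrite !mxE; congr (_ ^+ 2); ring.
    by apply/idP/idP; rewrite inE.
  rewrite (@ge0_integral_rV_shift _ _ (Y w) (fun x => (\1_A x * phi x w)%:E)); last 2 first.
  - by apply/measurable_EFinP; exact: measurable_funM.
  - by move=> x; rewrite lee_fin mulr_ge0.
  rewrite -ge0_integralZl//; last 3 first.
  - by apply/measurable_EFinP; exact: measurable_funM.
  - by move=> x _; rewrite lee_fin mulr_ge0.
  - by rewrite lee_fin invr_ge0 ltW.
  by apply: eq_integral => x _; rewrite -EFinM mulrA.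
rewrite -(@fubini_tonelli _ _ _ _ _ (lebesgue_rV d) P
    (fun z => (v^-1 * \1_A z.1 * phi z.1 z.2)%:E))/=; last 2 first.
- apply/measurable_EFinP; apply: measurable_funM; last exact: measurable_ball_kernel.
  by apply: measurable_funM => //; exact: (measurableT_comp m1A measurable_fst).
- by move=> z; rewrite lee_fin !mulr_ge0// invr_ge0 ltW.
rewrite [RHS]integral_mkcond; apply: eq_integral => x _.
under eq_integral do rewrite EFinM.
rewrite ge0_integralZl//; last 3 first.
- apply/measurable_EFinP.
  exact: (measurableT_comp measurable_ball_kernel (pair1_measurable x)).
- by move=> w _; rewrite lee_fin.
- by rewrite lee_fin mulr_ge0// invr_ge0 ltW.
rewrite ball_massE -EFinM patchE indicE; case: (x \in A); last by rewrite mulr0 mul0r.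
by rewrite mulr1.
Qed.

Lemma integral_density_sum_powR (v : R) k : 0 < v ->
  lebesgue_rV d (@euclidean_unit_ball R d) = v%:E ->
  (\int[lebesgue_rV d]_x ((density P (fun w => Y w + W w) x) `^ k%:R)%:E =
   (v^-1 ^+ k)%:E * iterated_integral P k
     (fun s => \int[lebesgue_rV d]_x (\prod_(w <- s) (sqdist x (Y w) < 1)%R%:R)%:E))%E.
Proof.
move=> v0 vE; have fD := is_density_sum v0 vE.
(* Since [fD] provides a density, [xget] picks a genuine one and not the default zero function. *)
have dD : is_density P (fun w => Y w + W w) (density P (fun w => Y w + W w)).
  by rewrite /density; case: xgetP => [f -> //|/(_ _ fD)].
rewrite (integral_density_powR _ dD fD).
have := @iterated_integral_prod _ _ _ P _ _ (lebesgue_rV d) phi ball_mass (fun=> 1) k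
  measurable_ball_kernel (fun x w => ler0n _ _) (measurable_cst _) (fun=> ler01)
  ball_massE.
rewrite -[X in iterated_integral P k X](_ : (fun s =>
   \int[lebesgue_rV d]_x (\prod_(w <- s) phi x w)%:E) = _)%E; last first.
  by apply/funext => s; apply: eq_integral => x _; rewrite mul1r.
move=> ->; rewrite -ge0_integralZl//; last 3 first.
- apply/measurable_EFinP; apply: measurable_funM => //; apply: measurable_funX.
  exact: measurable_ball_mass.
- by move=> x _; rewrite lee_fin mul1r exprn_ge0// ball_mass_ge0.
- by rewrite lee_fin exprn_ge0// invr_ge0 ltW.
apply: eq_integral => x _; rewrite -EFinM mul1r powR_mulrn ?exprMn//.
by rewrite mulr_ge0 ?ball_mass_ge0// invr_ge0 ltW.
Qed.

End sum_density.
End density.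

Theorem corollary1p2 (R : realType) (dO : measure_display)
    (Omega : measurableType dO) (P : probability Omega R) (d : nat)
    (X W : {RV P >-> 'rV[R]_d}) (T : 'rV[R]_d -> 'rV[R]_d) (alpha : nat) :
  (0 < d)%N ->
  euclidean_contraction T ->
  uniform_on P W (@euclidean_unit_ball R d) ->
  independent_RV P X W ->
  (2 <= alpha <= d + 3)%N ->
  (renyi_entropy P alpha%:R (fun w => (T (X w) + W w)%R)
   <= renyi_entropy P alpha%:R (fun w => (X w + W w)%R))%E.
Proof.
move=> _ cT uW XW /andP[a2 ad].
have mT := measurable_contraction cT.
have mTX : measurable_fun setT (T \o X).
  exact: measurableT_comp mT (measurable_funPT X).
pose TX : {RV P >-> 'rV[R]_d} :=
  HB.pack (T \o X) (isMeasurableFun.Build _ _ _ _ (T \o X) mTX).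
have TXW : independent_RV P TX W.
  move=> A B mA mB; rewrite -[TX @^-1` A]/(X @^-1` (T @^-1` A)); apply: XW => //.
  by rewrite -[X in measurable X]setTI; exact: mT.
have [v v0 vE] := uniform_on_volume (@measurable_unit_ball R d) uW.
rewrite /renyi_entropy (integral_density_sum_powR uW XW _ v0 vE).
rewrite (integral_density_sum_powR uW TXW _ v0 vE).
set I0 := iterated_integral P alpha _; set I1 := iterated_integral P alpha _.
have I0_ge0 : (0 <= I0)%E.
  apply: iterated_integral_ge0 => s; apply: integral_ge0 => x _.
  by rewrite lee_fin prodr_ge0.
have I1_ge0 : (0 <= I1)%E.
  apply: iterated_integral_ge0 => s; apply: integral_ge0 => x _.
  by rewrite lee_fin prodr_ge0.
(* The comparison is made for each list of outcomes: the centers in [I0] are the images under [T] of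
   those in [I1]. *)
have I10 : (I1 <= I0)%E.
  apply: le_iterated_integral => s.
    by apply: integral_ge0 => x _; rewrite lee_fin prodr_ge0.
  move=> sa; subst alpha.
  under eq_integral do rewrite big_tnth.
  under [leRHS]eq_integral do rewrite big_tnth.
  apply: kneser_poulsen_ball => //; first exact: leq_trans a2.
  by move=> i j; exact: contraction_sqdist.
have c0 : (0 <= (v^-1 ^+ alpha)%:E)%E by rewrite lee_fin exprn_ge0// invr_ge0 ltW.
(* The prefactor is negative because [alpha] is at least 2, so the larger integral gives the smaller
   entropy. *)
have -> : (1 - alpha%:R)^-1 = - (alpha%:R - 1)^-1 :> R by rewrite -invrN opprB.
rewrite EFinN !mulNe leeN2 lee_wpmul2l//.
  by rewrite lee_fin invr_ge0 subr_ge0 ler1n; exact: leq_trans a2.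
rewrite lee_lne ?in_itv/= ?leey ?andbT ?mule_ge0//.
exact: lee_wpmul2l.
Qed.
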